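(* Let $(Y_t)_{t}$ be an SDAR process, i.e. a stochastic process satisfying $$Y_t=\alpha+\psi(Y_{t-1};\boldsymbol{\gamma})\,Y_{t-1}+\xi_t,\qquad t\ge 1,\qquad Y_0=0,$$ where $(\xi_t)_t$ is i.i.d. normally distributed with mean zero and volatility (standard deviation) $\sigma>0$, and $\psi(\cdot;\boldsymbol{\gamma})$ is a measurable function. Assume that $\psi$ is differentiable with respect to $y$ and that $$|\psi(y;\boldsymbol{\gamma})|+\left|y\,\frac{d}{dy}\psi(y;\boldsymbol{\gamma})\right|\le K<1\qquad\text{for all } y\in\mathbb{R}.$$ Then, for any $\boldsymbol{\theta}=(\alpha,\boldsymbol{\gamma},\sigma)\in\Theta$, the SDAR model is strictly stationary.
   Context: SDAR stands for state-dependent first-order autoregressive process. The process $(Y_t)_{t\in\mathbb{N}}$ is defined on a complete probability space $(\mathbb{R}^{\infty},\mathfrak{B}(\mathbb{R}^{\infty}),\mathbb{P}^0)$. The function $\psi(Y_{t-1};\boldsymbol{\gamma})$, called the persistence function, is a measurable function of the lagged variable $Y_{t-1}$ depending on a $p$-dimensional vector of parameters $\boldsymbol{\gamma}$. The error term $\xi_t$ is independent of $Y_{t-1}$. The vector of model parameters $\boldsymbol{\theta}=(\alpha,\boldsymbol{\gamma},\sigma)$ belongs to $\Theta=\mathcal{A}\times\Gamma\times\mathcal{S}\subset\mathbb{R}^{p+2}$, where $\alpha\in\mathcal{A}$, $\boldsymbol{\gamma}\in\Gamma$ and $\sigma\in\mathcal{S}$. A process is strictly stationary if its finite-dimensional distributions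 are invariant under time shifts.
   Formalization: Started at Y_0=0 the process is never strictly stationary (Y_1 is normal, Y_0 constant); the formal claim is that, on an extended probability space, the equation with the same errors has a strictly stationary solution Y', and Y_t-Y'_t tends to 0 almost surely. *)

(* Defs.v *)
From HB Require Import structures.
From mathcomp Require Import all_boot all_order all_algebra finmap.
From mathcomp Require Import all_classical all_reals all_analysis.

Set Implicit Arguments.
Unset Strict Implicit.
Unset Printing Implicit Defensive.

Import Order.TTheory GRing.Theory Num.Theory.
Import numFieldNormedType.Exports.

Local Open Scope classical_set_scope.
Local Open Scope ring_scope.

Section processes.
Context {d : measure_display} {T : measurableType d} {R : realType}.
Variable P : probability T R.

Definition sample_at (X : nat -> T -> R) n (s : n.-tuple nat) (w : T) :
  n.-tuple R := [tuple X (tnth s i) w | i < n].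

Definition strictly_stationary (X : nat -> T -> R) : Prop :=
  forall (n : nat) (s : n.-tuple nat) (h : nat) (B : set (n.-tuple R)),
    measurable B ->
    P (sample_at (fun t => X (t + h)%N) s @^-1` B) =
    P (sample_at X s @^-1` B).

Definition mutually_independent (X : nat -> T -> R) : Prop :=
  forall (J : {fset nat}) (B : nat -> set R),
    (forall j, measurable (B j)) ->
    P (\bigcap_(j in [set` J]) X j @^-1` B j) =
    (\prod_(j <- J) P (X j @^-1` B j))%E.

(* [Z] is independent of the random vector [(X 0, ..., X t)]. *)
Definition independent_of_past (Z : T -> R) (X : nat -> T -> R) (t : nat) :
    Prop :=
  forall (A : set (t.+1.-tuple R)) (B : set R),
    measurable A -> measurable B ->
    let past := sample_at X [tuple (i : nat) | i < t.+1] in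
    P ((past @^-1` A) `&` (Z @^-1` B)) =
    (P (past @^-1` A) * P (Z @^-1` B))%E.

(* [Y] solves the SDAR equation with intercept [alpha], persistence function
   [f] and errors [(xi t)_(t >= 1)]; the value [xi 0] plays no role, and the
   initial value [Y 0] is left free.  When [Y 0] is constant the last clause
   follows from the other ones; for a random [Y 0] it contains the independence
   of [Y 0] from all the errors. *)
Definition sdar_solution (alpha : R) (f : R -> R) (sigma : R)
    (Y xi : nat -> {RV P >-> R}) : Prop :=
  [/\ forall t, {ae P, forall w,
        Y t.+1 w = alpha + f (Y t w) * Y t w + xi t.+1 w},
      forall t (B : set R), measurable B ->
        distribution P (xi t.+1) B = normal_prob 0 sigma B,
      mutually_independent (fun t => xi t.+1 : T -> R) &
      forall t, independent_of_past (xi t.+1) (fun s => Y s : T -> R) t].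

End processes.

(* A process started at the constant 0 is not itself stationary, so strict
   stationarity of the SDAR model is that of its equation: on an extension [T']
   of the probability space the equation, driven by the very same errors, has a
   strictly stationary solution [Y'], and the effect of the initial value of [Y]
   vanishes, [Y t - Y' t --> 0] almost surely. *)
Definition sdar_model_strictly_stationary (d : measure_display)
    (T : measurableType d) (R : realType) (P : probability T R)
    (alpha : R) (f : R -> R) (sigma : R) (Y xi : nat -> {RV P >-> R}) : Prop :=
  exists (d' : measure_display) (T' : measurableType d')
         (P' : probability T' R) (ext : {mfun T' >-> T}),
    (forall A, measurable A -> P' (ext @^-1` A) = P A) /\
    exists Y' xi' : nat -> {RV P' >-> R},
      [/\ forall t w, xi' t w = xi t (ext w),
          sdar_solution alpha f sigma Y' xi',
          strictly_stationary P' (fun t => Y' t : T' -> R) &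
          {ae P', forall w, Y t (ext w) - Y' t w @[t --> \oo] --> (0 : R)}].

(* Main.v *)
(* The map [g y = alpha + psi y * y] is a [K]-contraction by the mean value
   theorem.  The backward iterates [xi_1 + g (xi_2 + g (... + g 0))] are almost
   surely Cauchy, because their increments are at most [K ^+ n * |g 0 + xi_n|]
   and Borel-Cantelli with a normal tail bound makes these summable.  The law
   of the limit is invariant under [y |-> g y + xi].  On the product of the
   probability space with itself, the second factor carries the given errors
   and the first one provides an independent initial value with that law; the
   solution started from it is stationary, and contracts at rate [K ^+ t]
   towards any other solution driven by the same errors. *)
Require Import Defs.
From HB Require Import structures.
From mathcomp Require Import all_boot all_order all_algebra finmap.
From mathcomp Require Import all_classical all_reals all_analysis.
From mathcomp Require Import measurable_realfun.
From mathcomp Require Import ring.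

Set Implicit Arguments.
Unset Strict Implicit.
Unset Printing Implicit Defensive.

Import Order.TTheory GRing.Theory Num.Theory.
Import numFieldNormedType.Exports.

Local Open Scope classical_set_scope.
Local Open Scope ring_scope.

(** * Laws and independence of random sequences of reals *)

Lemma product_probabilityE {R : realType} d1 d2 (T1 : measurableType d1)
    (T2 : measurableType d2) (P1 : probability T1 R) (P2 : probability T2 R)
    (A : set T1) (B : set T2) : measurable A -> measurable B ->
  ((P1 \x P2)%E : probability _ R) (A `*` B) = (P1 A * P2 B)%E.
Proof. exact: product_measure1E. Qed.

Section sequence_space.
Context {R : realType}.
Implicit Types (B : nat -> set R) (u : nat -> R).

Definition cylinder n B : set (nat -> R) :=
  [set u | forall i, (i < n)%N -> B i (u i)].

Definition cylinders : set (set (nat -> R)) :=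
  [set C | exists n B, (forall i, measurable (B i)) /\ C = cylinder n B].

(** This is the product sigma-algebra on real sequences, presented by a generator closed under
    intersection so that uniqueness of measures applies. *)
Definition seqR := g_sigma_algebraType cylinders.

HB.instance Definition _ := Measurable.on seqR.

Lemma setI_closed_cylinders : setI_closed cylinders.
Proof.
move=> _ _ [n [B [mB ->]]] [m [D [mD ->]]].
(* Each cylinder is padded with [setT] beyond its own length to reach the common length. *)
exists (maxn n m), (fun i => (if (i < n)%N then B i else setT) `&`
                             (if (i < m)%N then D i else setT)).
split=> [i|]; first by apply: measurableI; case: ifP.
apply/seteqP; split=> [u [uB uD] i|u uBD].
  by rewrite leq_max => _; split; case: ifP => // im; [exact: uB|exact: uD].
by split=> i im; have := uBD i; rewrite leq_max im ?orbT => /(_ isT)[].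
Qed.

Lemma measurable_seqP d (T : measurableType d) (X : T -> seqR) :
  measurable_fun [set: T] X <->
  forall i, measurable_fun [set: T] (fun w => X w i).
Proof.
split=> [mX i|mX].
  apply: (@measurableT_comp _ _ _ _ _ _ (fun u : seqR => u i)) => // _ D mD.
  rewrite setTI; apply: sub_sigma_algebra.
  exists i.+1, (fun j => if j == i then D else setT).
  split=> [j|]; first by case: ifP.
  apply/seteqP; split=> [u Du j|u /(_ i (ltnSn i))]; last by rewrite eqxx.
  by case: eqP => // ->.
apply: (@measurability _ _ _ seqR setT X cylinders erefl) => _
  [_ [n [B [mB ->]]] <-].
rewrite setTI (_ : X @^-1` _ = \bigcap_(i in `I_n) (fun w => X w i) @^-1` B i)//.
apply: fin_bigcap_measurable => // i _.
by rewrite -[_ @^-1` _]setTI; exact: mX.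
Qed.

Lemma measurable_coord i : measurable_fun [set: seqR] (fun u : seqR => u i).
Proof. by move: i; apply/(@measurable_seqP _ seqR idfun); exact: measurable_id. Qed.

Section laws.
Context {d} {T : measurableType d} (P : probability T R).

(** Only initial segments of indices are tested: taking [B i] to be [setT] at unwanted indices
    recovers every finite set of indices. *)
Definition independent_seq (X : T -> seqR) := forall n B,
  (forall i, measurable (B i)) ->
  P (X @^-1` cylinder n B) = (\prod_(i < n) P [set w | B i (X w i)])%E.

End laws.

Section same_law.
Context {d1} {T1 : measurableType d1} (P1 : probability T1 R).
Context {d2} {T2 : measurableType d2} (P2 : probability T2 R).

(** Cylinders form a pi-system generating the sigma-algebra of [seqR], and the whole space is one of
    them, so two probability laws that agree on them coincide. *)
Lemma cylinder_law (X1 : T1 -> seqR) (X2 : T2 -> seqR) :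
  measurable_fun [set: T1] X1 -> measurable_fun [set: T2] X2 ->
  (forall n B, (forall i, measurable (B i)) ->
     P1 (X1 @^-1` cylinder n B) = P2 (X2 @^-1` cylinder n B)) ->
  forall C, measurable C -> P1 (X1 @^-1` C) = P2 (X2 @^-1` C).
Proof.
move=> mX1 mX2 X12 C mC.
pose f1 : {mfun T1 >-> seqR} := HB.pack X1 (isMeasurableFun.Build _ _ _ _ _ mX1).
pose f2 : {mfun T2 >-> seqR} := HB.pack X2 (isMeasurableFun.Build _ _ _ _ _ mX2).
have := @measure_unique _ R seqR cylinders (fun=> setT) erefl setI_closed_cylinders.
move=> /(_ _ _ (pushforward P1 f1) (pushforward P2 f2)); apply => //.
- move=> _; exists 0, (fun=> setT); split=> //.
  by apply/seteqP; split.
- by rewrite bigcup_const//; exists 0.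
- by move=> _ [n [B [mB ->]]]; exact: X12.
- by move=> _; rewrite /= /pushforward preimage_setT probability_setT ltry.
Qed.

(** Independence reduces the probability of a cylinder to marginals, and cylinders determine the
    law. *)
Lemma independent_same_law (X1 : T1 -> seqR) (X2 : T2 -> seqR) :
  measurable_fun [set: T1] X1 -> measurable_fun [set: T2] X2 ->
  independent_seq P1 X1 -> independent_seq P2 X2 ->
  (forall i (D : set R), measurable D ->
    P1 [set w | D (X1 w i)] = P2 [set w | D (X2 w i)]) ->
  forall C, measurable C -> P1 (X1 @^-1` C) = P2 (X2 @^-1` C).
Proof.
move=> mX1 mX2 iX1 iX2 X12; apply: cylinder_law => // n B mB.
by rewrite iX1// iX2//; apply: eq_bigr => i _; exact: X12.
Qed.

End same_law.

Definition shift_seq u : nat -> R := fun i => u i.+1.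

Definition cons_seq (a : R) u : nat -> R :=
  fun i => if i is j.+1 then u j else a.

Definition mix (A : pred nat) u v : nat -> R :=
  fun i => if A i then u i else v i.

Lemma measurable_shift_seq : measurable_fun [set: seqR] (shift_seq : seqR -> seqR).
Proof. by apply/measurable_seqP => i; exact: measurable_coord. Qed.

Section independence.
Context {d} {T : measurableType d} (P : probability T R) (X : T -> seqR).
Hypothesis mX : measurable_fun [set: T] X.
Hypothesis iX : independent_seq P X.

Let measurable_cylinder n B : (forall i, measurable (B i)) ->
  measurable (X @^-1` cylinder n B).
Proof.
move=> mB; rewrite -[_ @^-1` _]setTI; apply: mX => //.
by apply: sub_sigma_algebra; exists n, B.
Qed.

Let measurable_coord_X i : measurable_fun [set: T] (fun w => X w i).
Proof. exact: (measurable_seqP X).1. Qed.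

Let measurable_X i (D : set R) : measurable D -> measurable [set w | D (X w i)].
Proof.
by move=> mD; rewrite -[X in measurable X]setTI; exact: measurable_coord_X.
Qed.

Lemma independent_shift_seq : independent_seq P (fun w => shift_seq (X w) : seqR).
Proof.
move=> n B mB; pose B' i := if i is j.+1 then B j else [set: R].
have -> : (fun w => shift_seq (X w) : seqR) @^-1` cylinder n B =
    X @^-1` cylinder n.+1 B'.
  apply/seteqP; split => [w wB [|i]//|w wB i ni]; first exact: wB.
  exact: (wB i.+1).
rewrite iX; last by case=> //=.
by rewrite big_ord_recl/= probability_setT mul1e.
Qed.

Context {d'} {T' : measurableType d'} (P' : probability T' R).

Lemma measurable_cons_seq (z : T' -> R) : measurable_fun [set: T'] z ->
  measurable_fun [set: T' * T] (fun w => cons_seq (z w.1) (X w.2) : seqR).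
Proof.
move=> mz; apply/measurable_seqP => -[|i]/=; first exact: measurableT_comp.
exact: (measurableT_comp (measurable_coord_X i)).
Qed.

(** A cylinder for the extended sequence is a rectangle: the constraint on coordinate 0 concerns the
    first factor, the remaining ones, moved down by one index, the second. *)
Lemma independent_cons_seq (z : T' -> R) : measurable_fun [set: T'] z ->
  independent_seq (P' \x P)%E (fun w => cons_seq (z w.1) (X w.2) : seqR).
Proof.
move=> mz [|n] B mB.
  rewrite big_ord0 -[RHS](probability_setT (P' \x P)%E); congr (_ _).
  by apply/seteqP; split.
have mzB D : measurable D -> measurable [set w | D (z w)].
  by move=> mD; rewrite -[X in measurable X]setTI; exact: mz.
have -> : (fun w => cons_seq (z w.1) (X w.2) : seqR) @^-1` cylinder n.+1 B =
    [set w | B 0%N (z w)] `*` (X @^-1` cylinder n (B \o S)).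
  apply/seteqP; split => [w wB|w [wB0 wB] [|i] ni]//; last exact: wB.
  by split=> [|i ni]; [exact: (wB 0%N)|exact: (wB i.+1)].
rewrite product_probabilityE; [|exact: mzB|
  by apply: measurable_cylinder => i; exact: mB].
rewrite (iX n (fun i => mB i.+1)) [RHS]big_ord_recl/=; congr (_ * _)%E.
  rewrite -[LHS]mule1 -(probability_setT P) -product_probabilityE//;
    last exact: mzB.
  by congr (_ _); apply/seteqP; split=> // w [].
apply: eq_bigr => i _.
rewrite -[LHS]mul1e -(probability_setT P') -product_probabilityE//;
    last exact: measurable_X.
by congr (_ _); apply/seteqP; split=> // w [].
Qed.

Lemma measurable_mix A :
  measurable_fun [set: T * T] (fun w => mix A (X w.1) (X w.2) : seqR).
Proof.
apply/measurable_seqP => i; rewrite /mix; case: (A i).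
  exact: (measurableT_comp (measurable_coord_X i)).
exact: (measurableT_comp (measurable_coord_X i)).
Qed.

(** Decoupling device: quantities depending on disjoint blocks of coordinates can be moved to
    different factors of a product space. A cylinder becomes a rectangle of two cylinders, whose
    probabilities multiply back to the original product. *)
Lemma mix_law A C : measurable C ->
  ((P \x P)%E : probability _ R)
    ((fun w => mix A (X w.1) (X w.2) : seqR) @^-1` C) =
  P (X @^-1` C).
Proof.
apply: cylinder_law => //; first exact: measurable_mix.
move=> n B mB.
(* Each constraint is imposed in exactly one factor; in the other, [setT] contributes a factor 1. *)
pose B1 i := if A i then B i else [set: R].
pose B2 i := if A i then [set: R] else B i.
have mB1 i : measurable (B1 i) by rewrite /B1; case: ifP.
have mB2 i : measurable (B2 i) by rewrite /B2; case: ifP.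
have -> : (fun w => mix A (X w.1) (X w.2) : seqR) @^-1` cylinder n B =
    (X @^-1` cylinder n B1) `*` (X @^-1` cylinder n B2).
  apply/seteqP; split => [w wB|w [wB1 wB2] i ni].
    by split=> i ni; have := wB i ni; rewrite /mix /B1 /B2; case: ifP.
  by have := wB1 i ni; have := wB2 i ni; rewrite /mix /B1 /B2; case: ifP.
rewrite product_probabilityE; [|exact: measurable_cylinder..].
rewrite !iX// -big_split/=; apply: eq_bigr => i _; rewrite /B1 /B2.
by case: ifP => _; rewrite probability_setT ?mule1 ?mul1e.
Qed.

End independence.

End sequence_space.

Arguments seqR : clear implicits.

(** * Backward and forward iterates of a contraction with additive errors *)

Section contraction_recursion.
Context {R : realType}.
Variables (g : R -> R) (K : R).
Hypothesis K_lt1 : K < 1.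
Hypothesis g_lip : forall x y, `|g x - g y| <= K * `|x - y|.
Implicit Type u : nat -> R.

Let K_ge0 : 0 <= K.
Proof.
by have := le_trans (normr_ge0 _) (g_lip 1 0); rewrite subr0 normr1 mulr1.
Qed.

Lemma contraction_continuous : continuous g.
Proof.
move=> x; apply/cvgrPdist_le => e e0; near=> y.
apply: le_trans (g_lip _ _) _; apply: (@le_trans _ _ `|x - y|).
  by rewrite ler_piMl// ltW.
near: y; apply: cvgr_dist_le e0; exact: cvg_id.
Unshelve. all: by end_near. Qed.

Let measurable_g : measurable_fun [set: R] g.
Proof. exact: continuous_measurable_fun contraction_continuous. Qed.

(** Time runs backward along [u]: [u 0] is the latest error and [u i] the one [i] steps earlier.
    Lengthening the past changes only the innermost term, which is what makes pathwise convergence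
    possible. *)
Fixpoint backward n u : R :=
  if n is m.+1 then u 0%N + g (backward m (shift_seq u)) else 0.

(* The [limsup] makes the limit a measurable function on the whole space. *)
Definition backward_limit u : R :=
  fine (limn_esup (fun n => (backward n u)%:E)).

Lemma measurable_backward n :
  measurable_fun [set: seqR R] (backward n : seqR R -> R).
Proof.
elim: n => [|n IH] /=; first exact: measurable_cst.
apply: measurable_funD; first exact: measurable_coord.
apply: measurableT_comp => //; apply: measurableT_comp IH _.
exact: measurable_shift_seq.
Qed.

Lemma measurable_backward_limit :
  measurable_fun [set: seqR R] (backward_limit : seqR R -> R).
Proof.
apply: measurableT_comp; first exact: fine_measurable.
apply: measurable_fun_limn_esup => n.
by apply/measurable_EFinP; exact: measurable_backward.
Qed.

Lemma cvg_backward_limit u :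
  cvgn (backward ^~ u) -> backward n u @[n --> \oo] --> backward_limit u.
Proof.
move=> cu; rewrite /backward_limit.
have /cvg_limn_einf_sup[_ ->] : (backward n u)%:E @[n --> \oo] -->
    (limn (backward ^~ u))%:E by apply: cvg_EFin => //; exact: nearW.
exact: cu.
Qed.

(** Continuity of [g] allows passing to the limit in the defining equation of [backward n.+1]. *)
Lemma backward_limit_shift_seq u : cvgn (backward ^~ (shift_seq u)) ->
  backward_limit u = u 0%N + g (backward_limit (shift_seq u)).
Proof.
move=> /cvg_backward_limit cu.
have h : backward n.+1 u @[n --> \oo] --> u 0%N + g (backward_limit (shift_seq u)).
  apply: cvgD; first exact: cvg_cst.
  by apply: continuous_cvg => //; exact: contraction_continuous.
have {}h : backward n u @[n --> \oo] --> u 0%N + g (backward_limit (shift_seq u)).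
  by rewrite -(cvg_shiftS (backward ^~ u)).
have /cvg_backward_limit h' : cvgn (backward ^~ u).
  by apply/cvg_ex; eexists; exact: h.
exact: cvg_unique h' h.
Qed.

(** The two iterates differ only in their innermost value, [u n + g 0] against 0, and [n]
    applications of [g] each shrink the difference by [K]. *)
Lemma backward_increment n u :
  `|backward n.+1 u - backward n u| <= K ^+ n * `|g 0 + u n|.
Proof.
elim: n u => [|n IH] u; first by rewrite /= subr0 expr0 mul1r addrC.
rewrite [backward n.+2 u]/= [in X in _ - X]/= -/(backward n.+1 (shift_seq u)).
rewrite opprD addrACA subrr add0r exprS -mulrA.
by apply: le_trans (g_lip _ _) _; rewrite ler_wpM2l//; exact: IH.
Qed.

(** The given series dominates the increments, so their telescoping series converges absolutely; its
    partial sums are the iterates because [backward 0 u] is 0. *)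
Lemma is_cvg_backward u :
  cvgn (series (fun n => K ^+ n * `|g 0 + u n|)) -> cvgn (backward ^~ u).
Proof.
move=> cs.
have : cvgn (series (telescope (backward ^~ u))).
  apply: normed_cvg; apply: series_le_cvg cs => n //=.
    by rewrite mulr_ge0// exprn_ge0.
  exact: backward_increment.
rewrite telescopeK /=; move/cvg_ex => [l hl]; apply/cvg_ex; exists l.
by move: hl; under eq_fun do rewrite subr0.
Qed.

Fixpoint forward t u : R :=
  if t is s.+1 then g (forward s u) + u s.+1 else u 0%N.

(** The time shift of the process, lifted to its input: the initial value absorbs the first error
    and the later errors move down by one. Stationarity of [forward] thus reduces to invariance of
    the input law under [step]. *)
Definition step u : nat -> R :=
  fun i => if i is 0%N then g (u 0%N) + u 1%N else u i.+1.

Lemma forward_step t u : forward t (step u) = forward t.+1 u.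
Proof. by elim: t => //= t ->. Qed.

Lemma forward_iter_step t h u : forward t (iter h step u) = forward (t + h) u.
Proof.
elim: h t u => [|h IH] t u; first by rewrite addn0.
by rewrite iterS forward_step IH addSnnS.
Qed.

Lemma measurable_step : measurable_fun [set: seqR R] (step : seqR R -> seqR R).
Proof.
apply/measurable_seqP => -[|i]/=; last exact: measurable_coord.
apply: measurable_funD; last exact: measurable_coord.
by apply: measurableT_comp => //; exact: measurable_coord.
Qed.

Lemma measurable_forward t :
  measurable_fun [set: seqR R] (forward t : seqR R -> R).
Proof.
elim: t => [|t IH] /=; first exact: measurable_coord.
apply: measurable_funD; last exact: measurable_coord.
exact: measurableT_comp.
Qed.

(** Adaptedness, used to separate the past from the next error. *)
Lemma forward_eq t u v :
  (forall i, (i <= t)%N -> u i = v i) -> forward t u = forward t v.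
Proof.
elim: t => [|t IH] uv /=; first exact: uv.
by rewrite uv// IH// => i it; apply: uv; exact: leqW.
Qed.

(** The common error cancels in the difference, which therefore decays geometrically whatever the
    two initial values. *)
Lemma forward_contraction (y z e : nat -> R) :
  (forall t, y t.+1 = g (y t) + e t.+1) ->
  (forall t, z t.+1 = g (z t) + e t.+1) ->
  y t - z t @[t --> \oo] --> 0.
Proof.
move=> ye ze.
have yz t : `|y t - z t| <= K ^+ t * `|y 0%N - z 0%N|.
  elim: t => [|t IH]; first by rewrite expr0 mul1r.
  rewrite ye ze opprD addrACA subrr addr0 exprS -mulrA.
  by apply: le_trans (g_lip _ _) _; rewrite ler_wpM2l.
apply/norm_cvg0P.
apply: (@squeeze_cvgr _ _ _ _ (cst 0) (fun t => K ^+ t * `|y 0%N - z 0%N|)).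
- by apply: nearW => t; rewrite normr_ge0 yz.
- exact: cvg_cst.
- rewrite -[X in _ --> X](mul0r `|y 0%N - z 0%N|); apply: cvgMl.
  by apply: cvg_expr; rewrite ger0_norm.
Qed.

End contraction_recursion.

(** * Normal tails and almost sure summability *)

(** A quadratic tail bound suffices, since it is applied along geometrically growing thresholds. *)
Lemma normal_prob_tail {R : realType} (s : R) : 0 < s ->
  exists2 c : R, 0 <= c & forall a, 0 < a ->
    (normal_prob 0 s [set x | (a < `|x|)%R] <= (c / a ^+ 2)%:E)%E.
Proof.
move=> s0; have ss0 : 0 < 2 * s by rewrite mulr_gt0.
(* [y] is the gap between the exponents at scales [s] and [2 * s]: 1/2 - 1/8 = 3/8. In [c], the
   factor [8 / 3 * s ^+ 2] turns [y x] back into [x ^+ 2], and the peaks give the ratio of the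
   normalizing constants. *)
pose y (x : R) := (3 / 8) * x ^+ 2 / s ^+ 2.
pose c := normal_peak s / normal_peak (2 * s) * (8 / 3 * s ^+ 2).
have p0 : 0 < normal_peak (2 * s) by rewrite normal_peak_gt0 ?gt_eqF.
have c0 : 0 <= c.
  rewrite mulr_ge0// ?divr_ge0 ?normal_peak_ge0//.
  by rewrite mulr_ge0 ?sqr_ge0// divr_ge0.
exists c => // a a0.
(* Compare with the normal density of twice the scale, using
   [y * exp (- y) <= 1]. *)
have pdf_le x : x ^+ 2 * normal_pdf 0 s x <= c * normal_pdf 0 (2 * s) x.
  rewrite !normal_pdfE ?gt_eqF// /normal_fun !subr0.
  have -> : - x ^+ 2 / (s ^+ 2 *+ 2) =
      - x ^+ 2 / ((2 * s) ^+ 2 *+ 2) - y x by rewrite /y; field; rewrite gt_eqF.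
  rewrite expRD expRN; set E := expR (- x ^+ 2 / _).
  have -> : x ^+ 2 * (normal_peak s * (E * (expR (y x))^-1)) =
    (y x / expR (y x)) * (normal_peak s * (8 / 3 * s ^+ 2) * E).
    by rewrite /y; field; rewrite !gt_eqF ?expR_gt0.
  have -> : c * (normal_peak (2 * s) * E) = normal_peak s * (8 / 3 * s ^+ 2) * E.
    by rewrite /c; field; rewrite gt_eqF.
  rewrite ler_piMl//.
    rewrite mulr_ge0 ?expR_ge0// mulr_ge0 ?normal_peak_ge0//.
    by rewrite mulr_ge0 ?sqr_ge0// divr_ge0.
  rewrite ler_pdivrMr ?expR_gt0// mul1r (le_trans _ (expR_ge1Dx _))//.
  by rewrite lerDr.
have mD : measurable [set x : R | a < `|x|].
  rewrite -[X in measurable X]setTI.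
  by apply: measurable_fun_ltr => //; exact: measurable_normr.
rewrite /normal_prob.
(* On the event, [x ^+ 2 / a ^+ 2] is at least 1, so [pdf_le] applies; the wider density then has
   integral at most 1. *)
apply: (@le_trans _ _ (\int[lebesgue_measure]_(x in [set x : R | (a < `|x|)%R])
    ((c / a ^+ 2)%:E * (normal_pdf 0 (2 * s) x)%:E))%E).
  apply: ge0_le_integral => //=.
  - by move=> x _; rewrite lee_fin normal_pdf_ge0.
  - apply/measurable_funTS/measurable_EFinP; exact: measurable_normal_pdf.
  - apply/measurable_funTS/measurable_EFinP; apply: measurable_funM => //.
    exact: measurable_normal_pdf.
  - move=> x ax; rewrite lee_fin mulrAC ler_pdivlMr ?exprn_gt0//.
    apply: le_trans (pdf_le x); rewrite mulrC ler_wpM2r ?normal_pdf_ge0//.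
    by rewrite -(real_normK (num_real x)) lerXn2r ?nnegrE// ltW.
rewrite ge0_integralZl//; first last.
- by rewrite lee_fin divr_ge0// sqr_ge0.
- by move=> x _; rewrite lee_fin normal_pdf_ge0.
- apply/measurable_funTS/measurable_EFinP; exact: measurable_normal_pdf.
rewrite -[leRHS]mule1; apply: lee_wpmul2l.
  by rewrite lee_fin divr_ge0// sqr_ge0.
exact: (@probability_le1 _ _ _ (normal_prob 0 (2 * s))).
Qed.

(** For [r > 1] with [K * r < 1], the events [r ^+ n < |X n|] have summable probabilities. Almost
    surely only finitely many occur, and the terms are eventually below
    [|a| * K ^+ n + (K * r) ^+ n]. *)
Lemma ae_cvg_series_normal {R : realType} d (T : measurableType d)
    (P : probability T R) (X : nat -> T -> R) (s K a : R) :
  0 < s -> 0 <= K < 1 -> (forall n, measurable_fun [set: T] (X n)) ->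
  (forall n D, measurable D -> P (X n @^-1` D) = normal_prob 0 s D) ->
  {ae P, forall w, cvgn (series (fun n => K ^+ n * `|a + X n w|))}.
Proof.
move=> s0 /andP[K0 K1] mX PX.
have [c c0 tail] := normal_prob_tail s0.
(* The inverse of the midpoint of [K] and 1, hence strictly between 1 and [1 / K] when [K] is
   positive. *)
pose r := 2 / (1 + K).
have K1_gt0 : 0 < 1 + K by rewrite ltr_pwDl.
have r1 : 1 < r by rewrite ltr_pdivlMr// mul1r (_ : 2 = 1 + 1)// ltrD2l.
have r0 : 0 < r by exact: lt_trans r1.
have Kr1 : K * r < 1.
  by rewrite /r mulrA ltr_pdivrMr// mul1r mulr_natr mulr2n ltrD2r.
pose F n := [set w | r ^+ n < `|X n w|].
have mF n : measurable (F n).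
  rewrite -[X in measurable X]setTI; apply: measurable_fun_ltr => //.
  by apply: measurableT_comp => //; exact: measurable_normr.
have PF n : (P (F n) <= (geometric c (r ^- 2) n)%:E)%E.
  have -> : F n = X n @^-1` [set x | r ^+ n < `|x|] by [].
  rewrite PX; last first.
    rewrite -[X in measurable X]setTI.
    by apply: measurable_fun_ltr => //; exact: measurable_normr.
  apply: le_trans (tail _ (exprn_gt0 _ r0)) _.
  by rewrite /geometric/= lee_fin exprVn -!exprM mulnC.
have : P (lim_sup_set F) = 0.
  apply: lim_sup_set_cvg0 => //.
  apply: (@le_lt_trans _ _ (\sum_(n <oo) (geometric c (r ^- 2) n)%:E)%E).
    by apply: lee_nneseries => n *; [exact: measure_ge0|exact: PF].
  have cg : cvgn (series (geometric c (r ^- 2))).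
    apply: is_cvg_geometric_series.
    by rewrite ger0_norm ?invr_ge0 ?sqr_ge0// invf_lt1 ?exprn_gt0// exprn_egt1.
  have -> : (\sum_(n <oo) (geometric c (r ^- 2) n)%:E)%E =
      (limn (series (geometric c (r ^- 2))))%:E.
    rewrite -EFin_lim//; congr (limn _); apply/funext => n.
    by rewrite /= /series/= sumEFin.
  exact: ltry.
move=> PF0; exists (lim_sup_set F); split => //.
  by apply: bigcap_measurable => // k _; exact: bigcup_measurable.
move=> w /= ncvg; apply: contrapT => wF; apply: ncvg.
have [N hN] : exists N, forall n, (N <= n)%N -> `|X n w| <= r ^+ n.
  apply: contrapT => nN; apply: wF => N _; apply: contrapT => FN.
  apply: nN; exists N => n Nn; rewrite leNgt; apply/negP => Fn.
  by apply: FN; exists n.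
set u := fun n => _ : R.
(* Zeroing the first [N] terms makes the domination hold at every index without affecting
   convergence. *)
pose v n := if (n < N)%N then 0 else u n.
rewrite -(is_cvg_series_restrict N).
have -> : [sequence \sum_(N <= k < n) u k]_n = [sequence \sum_(N <= k < n) v k]_n.
  apply/funext => n; apply: eq_big_nat => i /andP[Ni _].
  by rewrite /v ltnNge Ni.
rewrite is_cvg_series_restrict.
apply: (@series_le_cvg _ _ (geometric `|a| K \+ geometric 1 (K * r))).
- by move=> n; rewrite /v; case: ifP => // _; rewrite mulr_ge0// exprn_ge0.
- by move=> n; rewrite addr_ge0// geometric_ge0// mulr_ge0// ltW.
- move=> n; rewrite /v; case: ltnP => [_|Nn].
    by rewrite addr_ge0// geometric_ge0// mulr_ge0// ltW.
  rewrite /u /geometric/= mul1r exprMn mulrC -[leRHS]/(`|a| * K ^+ n + K ^+ n * r ^+ n).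
  rewrite [K ^+ n * _]mulrC -mulrDl ler_wpM2r ?exprn_ge0//.
  by apply: le_trans (ler_normD _ _) _; rewrite lerD2l hN.
rewrite seriesD; apply: is_cvgD.
  by apply: is_cvg_geometric_series; rewrite ger0_norm.
by apply: is_cvg_geometric_series; rewrite ger0_norm// mulr_ge0// ltW.
Qed.

(** * Transfer of independence and of almost sure statements *)

Lemma mutually_independent_seq {R : realType} d (T : measurableType d)
    (P : probability T R) (X : nat -> T -> R) :
  mutually_independent P X ->
  independent_seq P (fun w => (fun i => X i w) : seqR R).
Proof.
move=> iX n B mB.
have := iX [fset k in iota 0 n]%fset B mB.
rewrite (_ : \bigcap_(j in _) _ =
    (fun w => (fun i => X i w) : seqR R) @^-1` cylinder n B); last first.
  apply/seteqP; split => [w wB i ni|w wB i /=].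
    by apply: wB; rewrite /= inE/= mem_iota.
  by rewrite inE/= mem_iota => /andP[_]; rewrite add0n; exact: wB.
move=> ->; rewrite (perm_big (iota 0 n)); last first.
  apply: uniq_perm; [exact: fset_uniq|exact: iota_uniq|].
  by move=> i; rewrite !inE.
by rewrite -[X in iota _ X]subn0 big_mkord.
Qed.

Lemma ae_snd {R : realType} d1 d2 (T1 : measurableType d1)
    (T2 : measurableType d2) (P1 : probability T1 R) (P2 : probability T2 R)
    (Q : T2 -> Prop) :
  {ae P2, forall w, Q w} -> {ae ((P1 \x P2)%E : probability _ R), forall w, Q w.2}.
Proof.
move=> [N [mN PN QN]]; exists (setT `*` N); split.
- exact: measurableX.
- by rewrite product_probabilityE// PN mule0.
- by move=> w wQ; split => //; exact: QN.
Qed.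

Lemma ae_eq_set_measure {R : realType} d (T : measurableType d)
    (P : {measure set T -> \bar R}) (A B : set T) :
  measurable A -> measurable B -> {ae P, forall w, A w <-> B w} -> P A = P B.
Proof.
move=> mA mB [N [mN PN ABN]].
have le_AB (C D : set T) : measurable C -> measurable D ->
    (forall w, ~ N w -> C w -> D w) -> (P C <= P D)%E.
  move=> mC mD CD; apply: (@le_trans _ _ (P (D `|` N))).
    rewrite le_measure ?inE//; first exact: measurableU.
    by move=> w Cw; have [Nw|nNw] := pselect (N w); [right|left; exact: CD].
  by apply: le_trans (measureU2 _ mD mN) _; rewrite [X in (_ + X)%E](_ : _ = 0%E)// adde0.
have ABn w : ~ N w -> A w <-> B w by move=> nNw; apply: contrapT => /ABN.
by apply/eqP; rewrite eq_le !le_AB// => w /ABn[].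
Qed.

(** * The stationary solution on the product space *)

Section stationary_solution.
Context {R : realType} (g : R -> R) (K : R).
Hypothesis K_lt1 : K < 1.
Hypothesis g_lip : forall x y, `|g x - g y| <= K * `|x - y|.
Context {d} {T : measurableType d} (P : probability T R).
Variable X : T -> seqR R.
Hypothesis mX : measurable_fun [set: T] X.
Hypothesis iX : independent_seq P X.
Hypothesis lawX : forall i j (D : set R), measurable D ->
  P [set w | D (X w i)] = P [set w | D (X w j)].
Hypothesis cvgX : {ae P, forall w, cvgn ((backward g) ^~ (shift_seq (X w)))}.

Let measurable_g : measurable_fun [set: R] g.
Proof.
exact: continuous_measurable_fun (contraction_continuous K_lt1 g_lip).
Qed.

Let Z w := backward_limit g (shift_seq (X w)).

Let mZ : measurable_fun [set: T] Z.
Proof.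
apply: (measurableT_comp (measurable_backward_limit K_lt1 g_lip)).
exact: measurableT_comp measurable_shift_seq mX.
Qed.

Let PP := (P \x P)%E : probability (T * T)%type R.

(** The two factors make the initial value independent of all errors. Coordinate [i.+1] is
    [X w.2 i], so with [X] listing the errors from time 1 on, coordinate [t] is the error of time
    [t]. *)
Definition start_seq (w : T * T) : seqR R := cons_seq (Z w.1) (X w.2).

Local Notation U := start_seq.

Lemma measurable_start_seq : measurable_fun [set: T * T] U.
Proof. exact: measurable_cons_seq. Qed.

Let mU := measurable_start_seq.

Lemma independent_start_seq : independent_seq PP U.
Proof. exact: independent_cons_seq. Qed.

Let iU := independent_start_seq.

Let start_lawS i (D : set R) : measurable D ->
  PP [set w | D (U w i.+1)] = P [set w | D (X w i)].
Proof.
move=> mD.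
have -> : [set w | D (U w i.+1)] = setT `*` [set w | D (X w i)].
  by apply/seteqP; split=> // w [].
rewrite product_probabilityE ?probability_setT ?mul1e//.
by rewrite -[X in measurable X]setTI; exact: (measurable_seqP X).1.
Qed.

Let start_law0 (D : set R) : measurable D ->
  PP [set w | D (U w 0%N)] = P [set w | D (Z w)].
Proof.
move=> mD.
have -> : [set w | D (U w 0%N)] = [set w | D (Z w)] `*` setT.
  by apply/seteqP; split=> // w [].
rewrite product_probabilityE ?probability_setT ?mule1//.
by rewrite -[X in measurable X]setTI; exact: mZ.
Qed.

(* With [W] the backward limit of [X], [Z] is its analogue for the shifted
   sequence: [Z] has the law of [W], is independent of [X 0], and
   [W = X 0 + g Z]. *)
Let step_law0 (D : set R) : measurable D ->
  PP [set w | D (step g (U w) 0%N)] = PP [set w | D (U w 0%N)].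
Proof.
move=> mD; rewrite start_law0//.
pose psi (u : seqR R) := backward_limit g u.
pose phi (u : seqR R) := u 0%N + g (psi (shift_seq u)).
have mpsi : measurable_fun [set: seqR R] psi.
  exact: (measurable_backward_limit K_lt1 g_lip).
have mphi : measurable_fun [set: seqR R] phi.
  apply: measurable_funD; first exact: measurable_coord.
  apply: measurableT_comp => //; apply: measurableT_comp mpsi _.
  exact: measurable_shift_seq.
have msX : measurable_fun [set: T] (fun w => shift_seq (X w) : seqR R).
  exact: measurableT_comp measurable_shift_seq mX.
have mpre (h : seqR R -> R) : measurable_fun [set: seqR R] h -> measurable (h @^-1` D).
  by move=> mh; rewrite -[X in measurable X]setTI; exact: mh.
have <- : P (X @^-1` (psi @^-1` D)) = P [set w | D (Z w)].
  apply: (@independent_same_law _ _ _ P _ _ P X (fun w => shift_seq (X w))) => //.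
  - exact: independent_shift_seq.
  - by move=> i E mE; exact: lawX.
  - exact: mpre.
have -> : P (X @^-1` (psi @^-1` D)) = P (X @^-1` (phi @^-1` D)).
  apply: ae_eq_set_measure.
  - by rewrite -[X in measurable X]setTI; exact: measurableT_comp mpsi mX measurableT _ mD.
  - by rewrite -[X in measurable X]setTI; exact: measurableT_comp mphi mX measurableT _ mD.
  - apply: filterS cvgX => w cw.
    by rewrite /= /psi (backward_limit_shift_seq K_lt1 g_lip cw).
(* Coordinate 0 is taken from the second factor and all others from the first, which turns [phi]
   into [g (Z w.1) + X w.2 0]. *)
rewrite -(mix_law mX iX [pred i | i != 0%N]); last exact: mpre.
congr (PP _); apply/seteqP.
have E w : phi (mix [pred i | i != 0%N] (X w.1) (X w.2)) = step g (U w) 0%N.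
  by rewrite /phi /= addrC.
by split=> w /=; rewrite E.
Qed.

(** The first entry of [step g U] depends only on coordinates 0 and 1 of [U], the rest only on later
    ones, so its entries are again independent. The marginals agree by [step_law0] and because the
    errors share one law. *)
Lemma step_law C : measurable C ->
  PP ((fun w => step g (U w) : seqR R) @^-1` C) = PP (U @^-1` C).
Proof.
move=> mC.
pose s (u : seqR R) : seqR R := step g u.
have ms : measurable_fun [set: seqR R] s by exact: (measurable_step K_lt1 g_lip).
have msC : measurable (s @^-1` C) by rewrite -[X in measurable X]setTI; exact: ms.
rewrite -[LHS]/(PP (U @^-1` (s @^-1` C))).
(* The two blocks go to separate factors, where the result is the prepended sequence [V]. *)
rewrite -(mix_law mU iU [pred i | (i < 2)%N] msC).
pose V (w : (T * T) * (T * T)) : seqR R :=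
  cons_seq (step g (U w.1) 0%N) (shift_seq (shift_seq (U w.2))).
have mz : measurable_fun [set: T * T] (fun w => step g (U w) 0%N).
  exact: measurableT_comp (measurableT_comp (measurable_coord 0%N) ms) mU.
have mssU : measurable_fun [set: T * T]
    (fun w => shift_seq (shift_seq (U w)) : seqR R).
  apply: (measurableT_comp measurable_shift_seq).
  exact: measurableT_comp measurable_shift_seq mU.
have mV : measurable_fun [set: (T * T) * (T * T)] V.
  exact: (measurable_cons_seq mssU mz).
have iV : independent_seq (PP \x PP)%E V.
  have issU : independent_seq PP (fun w => shift_seq (shift_seq (U w)) : seqR R).
    exact: (independent_shift_seq (independent_shift_seq iU)).
  exact: (independent_cons_seq mssU issU PP mz).
pose PP2 := (PP \x PP)%E : probability ((T * T) * (T * T))%type R.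
have <- : PP2 (V @^-1` C) = PP (U @^-1` C).
  apply: (independent_same_law mV mU iV iU) => [[|i] D mD|]; last exact: mC.
  - rewrite -step_law0//.
    have -> : [set w | D (V w 0%N)] = [set w | D (step g (U w) 0%N)] `*` setT.
      by apply/seteqP; split=> // w [].
    rewrite product_probabilityE ?probability_setT ?mule1//.
    by rewrite -[X in measurable X]setTI; exact: mz.
  - have -> : [set w | D (V w i.+1)] = setT `*` [set w | D (U w i.+2)].
      by apply/seteqP; split=> // w [].
    rewrite product_probabilityE ?probability_setT ?mul1e//.
      by rewrite !start_lawS//; exact: lawX.
    by rewrite -[X in measurable X]setTI; exact: (measurable_seqP U).1.
congr (PP2 _).
have E w : s (mix [pred i | (i < 2)%N] (U w.1) (U w.2)) = V w.
  by apply/funext => -[|i].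
by apply/seteqP; split=> w /=; rewrite E.
Qed.

Lemma iter_step_law h C : measurable C ->
  PP ((fun w => iter h (step g) (U w) : seqR R) @^-1` C) = PP (U @^-1` C).
Proof.
elim: h C => // h IH C mC.
have msC : measurable ((step g : seqR R -> seqR R) @^-1` C).
  by rewrite -[X in measurable X]setTI; exact: (measurable_step K_lt1 g_lip).
by rewrite -step_law// -(IH _ msC).
Qed.

Let msample n (s : n.-tuple nat) : measurable_fun [set: seqR R]
  (fun u : seqR R => [tuple forward g (tnth s i) u | i < n]).
Proof.
apply/measurable_fun_tnthP => i.
rewrite (_ : _ \o _ = (forward g (tnth s i) : seqR R -> R)); last first.
  by apply/funext => u /=; rewrite tnth_mktuple.
exact: (measurable_forward K_lt1 g_lip).
Qed.

(** Shifting time by [h] amounts to feeding [iter h (step g) U] to [forward], and this input has the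
    law of [U]. *)
Lemma forward_strictly_stationary :
  strictly_stationary PP (fun t w => forward g t (U w)).
Proof.
move=> n s h B mB.
have := iter_step_law h (_ : measurable
  ((fun u : seqR R => [tuple forward g (tnth s i) u | i < n]) @^-1` B)).
rewrite -[X in measurable X]setTI => /(_ (msample s measurableT mB)) <-.
congr (PP _); apply/seteqP.
have E w : sample_at (fun t w => forward g (t + h)%N (U w)) s w =
    [tuple forward g (tnth s i) (iter h (step g) (U w)) | i < n].
  by apply: eq_from_tnth => i; rewrite !tnth_mktuple forward_iter_step.
by split=> w /=; rewrite E.
Qed.

Lemma forward_independent_of_past t :
  independent_of_past PP (fun w => U w t.+1) (fun s w => forward g s (U w)) t.
Proof.
move=> A B mA mB /=.
pose past (u : seqR R) :=
  [tuple forward g (tnth [tuple (i : nat) | i < t.+1] i) u | i < t.+1].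
have mpast : measurable_fun [set: seqR R] past by exact: msample.
have mpA : measurable (past @^-1` A) by rewrite -[X in measurable X]setTI; exact: mpast.
have mtB : measurable [set u : seqR R | B (u t.+1)].
  by rewrite -[X in measurable X]setTI; exact: measurable_coord.
rewrite -[LHS]/(PP (U @^-1` ((past @^-1` A) `&` [set u : seqR R | B (u t.+1)]))).
(* The past reads coordinates up to [t], the error only coordinate [t.+1]; on separate factors the
   joint event is a rectangle. *)
rewrite -(mix_law mU iU [pred i | (i <= t)%N]); last exact: measurableI.
rewrite -[RHS]/(PP (U @^-1` (past @^-1` A)) * PP (U @^-1` [set u | B (u t.+1)]))%E.
rewrite -product_probabilityE; last 2 first.
- by rewrite -[X in measurable X]setTI; exact: mU.
- by rewrite -[X in measurable X]setTI; exact: mU.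
congr ((PP \x PP)%E _).
have E w : past (mix [pred i | (i <= t)%N] (U w.1) (U w.2)) = past (U w.1).
  apply: eq_from_tnth => i; rewrite !tnth_mktuple.
  apply: forward_eq => j ji; rewrite /mix /= ifT//.
  by rewrite (leq_trans ji)// -ltnS.
apply/seteqP; split => w /=; rewrite E /mix /= ltnn; by case.
Qed.

End stationary_solution.

(** * The contraction estimate and the theorem *)

(** The derivative of the map is [y * f' y + f y], bounded by [K] through the triangle
    inequality. *)
Lemma affine_persistence_lipschitz {R : realType} (f : R -> R) (alpha K : R) :
  (forall y, derivable f y 1) ->
  (forall y, `|f y| + `|y * derive1 f y| <= K) ->
  forall x y, `|(alpha + f x * x) - (alpha + f y * y)| <= K * `|x - y|.
Proof.
move=> df fK.
pose g := fun y : R => alpha + f y * y.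
have dg (y : R) : is_derive y (1 : R) g (y * derive1 f y + f y).
  have dfy : is_derive y (1 : R) f (derive1 f y).
    by rewrite derive1E; exact/derivableP/df.
  have := is_deriveD (is_derive_cst alpha y 1) (is_deriveM dfy (is_derive_id y 1)).
  move=> h; rewrite (_ : g = cst alpha + f * id); last by apply/funext.
  apply: is_derive_eq.
  by rewrite add0r /= [_%:A]mulr1 addrC.
suff h x y : x <= y -> `|g x - g y| <= K * `|x - y|.
  move=> x y; have [xy|/ltW yx] := leP x y; first exact: h.
  by have := h _ _ yx; rewrite distrC (distrC y).
move=> xy.
have cg : {within `[x, y], continuous g}.
  apply: continuous_subspaceT => z; apply: differentiable_continuous.
  by apply/derivable1_diffP; have [] := dg z.
have [c _ gyx] := MVT_segment xy (fun z _ => dg z) cg.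
rewrite distrC gyx normrM distrC ler_wpM2r//.
by apply: le_trans (ler_normD _ _) _; rewrite addrC.
Qed.

Theorem proposition1 (R : realType) (p : nat)
  (calA : set R) (Gamma : set 'rV[R]_p) (calS : set R)
  (calS_gt0 : forall s, calS s -> 0 < s)
  (psi : R -> 'rV[R]_p -> R) (K : R)
  (psi_measurable : forall gamma, Gamma gamma ->
     measurable_fun [set: R] (fun y => psi y gamma))
  (psi_derivable : forall gamma, Gamma gamma ->
     forall y : R, derivable (fun z : R => psi z gamma) y 1)
  (K_lt1 : K < 1)
  (psi_contraction : forall gamma, Gamma gamma -> forall y : R,
     `|psi y gamma| + `|y * derive1 (fun z : R => psi z gamma) y| <= K)
  (alpha : R) (gamma : 'rV[R]_p) (sigma : R)
  (theta_in : calA alpha /\ Gamma gamma /\ calS sigma)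
  (d : measure_display) (T : measurableType d) (P : probability T R)
  (Y xi : nat -> {RV P >-> R})
  (Y_init : {ae P, forall w, Y 0%N w = 0})
  (Y_sdar : sdar_solution alpha (fun y => psi y gamma) sigma Y xi) :
  sdar_model_strictly_stationary alpha (fun y => psi y gamma) sigma Y xi.
Proof.
have [_ [Gg /calS_gt0 s0]] := theta_in.
have [Yeq xilaw xiindep _] := Y_sdar.
pose g (y : R) := alpha + psi y gamma * y.
have g_lip : forall x y, `|g x - g y| <= K * `|x - y|.
  exact: (affine_persistence_lipschitz alpha (psi_derivable _ Gg)
    (psi_contraction _ Gg)).
have K_ge0 : 0 <= K.
  by apply: le_trans (psi_contraction _ Gg 0); rewrite addr_ge0.
pose X (w : T) : seqR R := fun i => xi i.+1 w.
have mX : measurable_fun [set: T] X.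
  by apply/measurable_seqP => i; exact: measurable_funPT.
have iX : independent_seq P X by exact: mutually_independent_seq.
have Xlaw i (D : set R) : measurable D ->
    P [set w | D (X w i)] = normal_prob 0 sigma D.
  exact: xilaw.
have lawX i j (D : set R) : measurable D ->
    P [set w | D (X w i)] = P [set w | D (X w j)].
  by move=> mD; rewrite !Xlaw.
have cvgX : {ae P, forall w, cvgn ((backward g) ^~ (shift_seq (X w)))}.
  (* The offset [g 0] is the one in [backward_increment]; the index [i.+1] reflects that the limit
     is taken along [shift_seq (X w)]. *)
  have := @ae_cvg_series_normal R _ T P (fun i w => X w i.+1) sigma K (g 0) s0.
  rewrite K_ge0 K_lt1 => /(_ isT).
  have mX' i : measurable_fun [set: T] (fun w => X w i.+1) by exact: measurable_funPT.
  move=> /(_ mX' (fun i => Xlaw i.+1)); apply: filterS => w.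
  exact: (is_cvg_backward g_lip).
pose PP := (P \x P)%E : probability (T * T)%type R.
pose U : T * T -> seqR R := start_seq g X.
have mU : measurable_fun [set: T * T] U by exact: (measurable_start_seq K_lt1 g_lip mX).
have mext : measurable_fun [set: T * T] (snd : T * T -> T) by exact: measurable_snd.
pose ext : {mfun (T * T)%type >-> T} := HB.pack (snd : T * T -> T)
  (isMeasurableFun.Build _ _ _ _ _ mext).
have extP A : measurable A -> PP (ext @^-1` A) = P A.
  move=> mA; rewrite -[RHS]mul1e -(probability_setT P) -product_probabilityE//.
  by congr (PP _); apply/seteqP; split=> // w [].
have mY' t : measurable_fun [set: T * T] (fun w => forward g t (U w)).
  exact: (measurableT_comp (measurable_forward K_lt1 g_lip t) mU).
pose Y' t : {RV PP >-> R} := HB.pack (fun w => forward g t (U w))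
  (isMeasurableFun.Build _ _ _ _ _ (mY' t)).
have mxi' t : measurable_fun [set: T * T] (xi t \o ext).
  exact: (measurableT_comp (measurable_funPT (xi t)) mext).
pose xi' t : {RV PP >-> R} := HB.pack (xi t \o ext)
  (isMeasurableFun.Build _ _ _ _ _ (mxi' t)).
exists _, (T * T)%type, PP, ext; split; first exact: extP.
exists Y', xi'; split => //.
- split.
  (* [forward] satisfies the equation at every point by computation. *)
  + by move=> t; exact: aeW.
  + move=> t B mB; rewrite -(xilaw t B mB).
    have mxiB : measurable (xi t.+1 @^-1` B).
      by rewrite -[X in measurable X]setTI; exact: measurable_funPT.
    exact: (extP _ mxiB).
  + move=> J B mB.
    have mxiB j : measurable (xi j.+1 @^-1` B j).
      by rewrite -[X in measurable X]setTI; exact: measurable_funPT.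
    transitivity (P (\bigcap_(j in [set` J]) (xi j.+1 @^-1` B j))).
      by apply: extP; apply: fin_bigcap_measurable.
    rewrite xiindep//; apply: eq_bigr => j _.
    by rewrite -extP.
  + exact: (forward_independent_of_past K_lt1 g_lip mX iX).
- exact: (forward_strictly_stationary K_lt1 g_lip mX iX lawX cvgX).
(* Countably many almost sure equations hold jointly off one null set, which pulls back along the
   second projection; the contraction is then applied path by path. *)
- have := ae_foralln Yeq.
  move=> /(ae_snd P); apply: filterS => w Yw.
  apply: (forward_contraction K_lt1 g_lip (e := fun t => xi t w.2)).
    exact: Yw.
  by move=> t.
Qed.
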